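(* Let $(M,g)=(I\times_fF,\,-dt^2+f(t)^2g_F)$ be a generalized Robertson–Walker spacetime. Suppose there exists $t_0\in\overline{I}$ such that $f(t)\to0$ as $t\to t_0$. Then there exist timelike geodesics that are incomplete.
   Context: A generalized Robertson–Walker spacetime is a warped product $M=I\times_fF$, where $I\subset\mathbb{R}$ is an interval, $(F,g_F)$ is a Riemannian manifold, $f>0$ is a smooth function on $I$, and $g=-dt^2+f(t)^2g_F$. $\overline{I}$ is the closure of $I$ in $\mathbb{R}$ (so $t_0$ is finite). *)

(* Defs.v *)
From HB Require Import structures.
From mathcomp Require Import all_boot all_order all_algebra.
From mathcomp Require Import all_classical all_reals all_analysis.

Set Implicit Arguments.
Unset Strict Implicit.
Unset Printing Implicit Defensive.

Import Order.TTheory GRing.Theory Num.Theory numFieldNormedType.Exports.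

Local Open Scope classical_set_scope.
Local Open Scope ring_scope.

(* C^oo on an open set U (in finite dimension): every iterated directional
   derivative of f exists and is continuous at every point of U. *)
Definition smooth_on (R : realType) (V W : normedModType R)
    (U : set V) (f : V -> W) : Prop :=
  forall (vs : seq V) (x : V), U x ->
    let h := foldr (fun v k => 'D_v k) f vs in
    {for x, continuous h} /\ forall v, derivable h x v.

(* The total functions [coord a] and [param a] are only meaningful on the sets
   [dom a] and [coord a @` dom a].  The underlying space of the manifold is the
   union of the [dom a], an open subset of T. *)
Record atlas (R : realType) (n : nat) (T : topologicalType) := Atlas {
  chart : Type;
  dom : chart -> set T;
  coord : chart -> T -> 'rV[R]_n;
  param : chart -> 'rV[R]_n -> T }.

Definition range_chart (R : realType) (n : nat) (T : topologicalType)
  (A : atlas R n T) (a : chart A) : set 'rV[R]_n := coord a @` dom a.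

Record smooth_manifold (R : realType) (n : nat) (T : topologicalType)
    (A : atlas R n T) : Prop := SmoothManifold {
  manifold_nonempty : [set: T] !=set0;
  manifold_hausdorff : hausdorff_space T;
  manifold_second_countable : @second_countable T;
  charts_cover : forall p, exists a : chart A, dom a p;
  dom_open : forall a : chart A, open (dom a);
  range_open : forall a : chart A, open (range_chart a);
  coordK : forall (a : chart A) p, dom a p -> param a (coord a p) = p;
  coord_continuous : forall (a : chart A) p,
    dom a p -> {for p, continuous (coord a)};
  param_continuous : forall (a : chart A) x,
    range_chart a x -> {for x, continuous (param a)};
  transition_smooth : forall a b : chart A,
    smooth_on (coord a @` (dom a `&` dom b)) (coord b \o param a) }.

(* [g a x] is the matrix (g_ij) of the metric in the chart a, as a function of
   the coordinates x. *)
Definition metric (R : realType) (n : nat) (T : topologicalType)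
  (A : atlas R n T) := chart A -> 'rV[R]_n -> 'M[R]_n.

Definition bilin (R : realType) (n : nat) (G : 'M[R]_n) (v w : 'rV[R]_n) : R :=
  (v *m G *m w^T) 0 0.

Record riemannian_manifold (R : realType) (n : nat) (T : topologicalType)
    (A : atlas R n T) (g : metric A) : Prop := RiemannianManifold {
  riemannian_smooth_manifold : smooth_manifold A;
  metric_smooth : forall (a : chart A) i j,
    smooth_on (range_chart a) (fun x => g a x i j);
  metric_sym : forall (a : chart A) x, range_chart a x -> (g a x)^T = g a x;
  metric_pos : forall (a : chart A) x v,
    range_chart a x -> v != 0 -> 0 < bilin (g a x) v v;
  (* (0,2)-tensor transformation law under a change of charts *)
  metric_tensor : forall (a b : chart A) p v w, dom a p -> dom b p ->
    let tau := coord b \o param a in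
    bilin (g a (coord a p)) v w =
    bilin (g b (coord b p)) ('D_v tau (coord a p)) ('D_w tau (coord a p)) }.

Definition partial (R : realType) (n : nat) (i : 'I_n) (h : 'rV[R]_n -> R) :
  'rV[R]_n -> R := 'D_(delta_mx 0 i) h.

(* Gamma^k_ij of the Levi-Civita connection *)
Definition christoffel (R : realType) (n : nat) (G : 'rV[R]_n -> 'M[R]_n)
    (k i j : 'I_n) (x : 'rV[R]_n) : R :=
  2^-1 * \sum_(l < n) invmx (G x) k l *
    (partial i (fun y => G y j l) x + partial j (fun y => G y i l) x
     - partial l (fun y => G y i j) x).

Section Curves.
Variables (R : realType) (n : nat) (T : topologicalType) (A : atlas R n T).
Variable g : metric A.

(* Only the values of gamma on the open interval J are relevant. *)
Record geodesic (J : set R) (gamma : R -> T) : Prop := Geodesic {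
  geodesic_open : open J;
  geodesic_interval : is_interval J;
  geodesic_nonempty : J !=set0;
  geodesic_in : forall s, J s -> exists a : chart A, dom a (gamma s);
  geodesic_continuous : forall s, J s -> {for s, continuous gamma};
  geodesic_smooth : forall a : chart A,
    smooth_on (J `&` gamma @^-1` dom a) (coord a \o gamma);
  geodesic_eq : forall (a : chart A) s, J s -> dom a (gamma s) ->
    let x := coord a \o gamma in
    forall k : 'I_n,
      (x^`(2))%classic s 0 k + \sum_(i < n) \sum_(j < n)
        christoffel (g a) k i j (x s) * x^`()%classic s 0 i * x^`()%classic s 0 j = 0 }.

Definition timelike (J : set R) (gamma : R -> T) : Prop :=
  forall (a : chart A) s, J s -> dom a (gamma s) ->
    let v := (coord a \o gamma)^`()%classic s in
    bilin (g a (coord a (gamma s))) v v < 0.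

Definition inextendible_geodesic (J : set R) (gamma : R -> T) : Prop :=
  geodesic J gamma /\
  forall (J' : set R) (gamma' : R -> T), geodesic J' gamma' -> J `<=` J' ->
    (forall s, J s -> gamma' s = gamma s) -> J' = J.

Definition incomplete_geodesic (J : set R) (gamma : R -> T) : Prop :=
  inextendible_geodesic J gamma /\ J <> setT.

End Curves.

Section WarpedProduct.
Variables (R : realType) (n : nat) (F : topologicalType) (A : atlas R n F).
Variables (I : set R) (f : R -> R) (gF : metric A).

(* The product manifold I x F inside R x F: the charts of F times the identity
   of I, with time as coordinate number 0. *)
Definition grw_atlas : atlas R (1 + n) (R * F)%type := {|
  chart := chart A;
  dom a := I `*` dom a;
  coord a p := row_mx (p.1)%:M (coord a p.2);
  param a x := (lsubmx x 0 0, param a (rsubmx x)) |}.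

Definition grw_metric : metric grw_atlas := fun (a : chart A) x =>
  block_mx (-1)%:M 0 0 (f (lsubmx x 0 0) ^+ 2 *: gF a (rsubmx x)).

(* As I is open, the spacetime I x F has no boundary. *)
Record grw_spacetime : Prop := GRWSpacetime {
  grw_open : open I;
  grw_interval : is_interval I;
  grw_nonempty : I !=set0;
  grw_fiber : riemannian_manifold gF;
  grw_warping_smooth : smooth_on I f;
  grw_warping_pos : forall t, I t -> 0 < f t }.

End WarpedProduct.

Arguments grw_metric {R n F A} I f gF.

(* Main.v *)
Require Import Defs.
From HB Require Import structures.
From mathcomp Require Import all_boot all_order all_algebra.
From mathcomp Require Import all_classical all_reals all_analysis.
Import Order.TTheory GRing.Theory Num.Theory numFieldNormedType.Exports.

Set Implicit Arguments.
Unset Strict Implicit.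
Unset Printing Implicit Defensive.

Local Open Scope classical_set_scope.
Local Open Scope ring_scope.

(** The curve s |-> (s, p) that follows the time coordinate above a fixed point
    p of the fibre is a timelike geodesic, whatever the warping function is: it
    is affine in every chart, with velocity the time direction e_0, so that the
    geodesic equation reduces to Gamma^k_00 = 0, and this holds because the
    entries g_0l of the metric are constant ([christoffel_time]).

    This geodesic is parametrized by I, and it is inextendible: an extension to
    J' has time component equal to s on I, hence by continuity on the closure of
    I in J'; as the time component takes its values in I, the interval I is
    closed in J', and it is open, so I = J' by connectedness
    ([comoving_geodesic_inextendible]).

    Incompleteness then means that I is not the whole line.  If t0 were in I,
    then f would be continuous and positive there and could not tend to 0
    ([vanishing_limit_notin]). *)

Section AffineCurve.
Variables (R : realType) (V : normedModType R).
Implicit Types (b c : V).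

Lemma is_derive_affine b c (s v : R) :
  is_derive s v (fun t : R => t *: b + c) (v *: b).
Proof.
have h : is_derive s v (fun t : R => t *: b) (v *: b).
  apply: DeriveDef.
    exact/diff_derivable/differentiableZl.
  rewrite deriveE; last exact/differentiableZl.
  by rewrite diffZl// diff_val.
rewrite -[v *: b]addr0.
exact: is_deriveD.
Qed.

Lemma derive1_affine b c : (fun t : R => t *: b + c)^`()%classic = cst b.
Proof.
apply/funext => s; rewrite derive1E.
by have [_ ->] := is_derive_affine b c s 1; rewrite scale1r.
Qed.

Lemma derive1n2_affine b c : (fun t : R => t *: b + c)^`(2)%classic = cst 0.
Proof.
by rewrite derive1nS derive1n1 derive1_affine; apply/funext => s;
   rewrite derive1_cst.
Qed.

(** The affine maps are stable under directional derivatives, so the iterated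
    derivatives never leave this class. *)
Lemma smooth_affine b c (U : set R) : smooth_on U (fun t : R => t *: b + c).
Proof.
move=> vs s _ /=.
have [b' [c' ->]] : exists b' c',
    foldr (fun v k => 'D_v k) (fun t : R => t *: b + c) vs =
    (fun t : R => t *: b' + c').
  elim: vs => [|v vs [b' [c' /= ->]]]; first by exists b, c.
  exists 0, (v *: b'); apply/funext => t.
  by have [_ ->] := is_derive_affine b' c' t v; rewrite scaler0 add0r.
split=> [|v]; last by have [] := is_derive_affine b' c' s v.
apply: differentiable_continuous; apply/derivable1_diffP.
by have [] := is_derive_affine b' c' s 1.
Qed.

End AffineCurve.

Lemma eq_on_closure (T : topologicalType) (R : realType) (u v : T -> R)
    (S : set T) (e : T) :
  (forall s, S s -> u s = v s) -> closure S e ->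
  {for e, continuous u} -> {for e, continuous v} -> u e = v e.
Proof.
move=> uv Se uc vc; apply/eqP; apply: contrapT => /negP ne.
have /Se [s [/uv us /= nes]] : nbhs e [set s | u s - v s != 0].
  have cuv : u s - v s @[s --> e] --> u e - v e by exact: cvgB.
  apply: (cuv [set z | z != 0]); apply: open_nbhs_nbhs.
  by split; [exact: open_neq|rewrite /= subr_eq0].
by move: nes; rewrite us subrr eqxx.
Qed.

Section ComovingGeodesic.
Variables (R : realType) (n : nat) (F : topologicalType) (A : atlas R n F).
Variables (gF : metric A) (I : set R) (f : R -> R).
Variable p : F.

Let gamma (s : R) : R * F := (s, p).
Let e0 : 'rV[R]_(1 + n) := row_mx 1%:M 0.

Lemma coord_comoving (a : chart (grw_atlas A I)) :
  Defs.coord a \o gamma =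
  (fun s : R => s *: e0 + row_mx 0 (@Defs.coord _ _ _ A a p)).
Proof.
apply/funext => s /=.
by rewrite /e0 scale_row_mx scaler0 add_row_mx addr0 add0r scalemx1.
Qed.

Lemma grw_metric_time (a : chart A) j y :
  grw_metric I f gF a y 0 j = - (j == 0)%:R.
Proof.
(* expose the index 0 as one of the upper left block *)
have -> : (0 : 'I_(1 + n)) = lshift n (0 : 'I_1) by exact/val_inj.
rewrite /grw_metric; case: (split_ordP j) => k ->.
  by rewrite block_mxEul !mxE (inj_eq (@lshift_inj _ _)) eq_sym mulNrn.
by rewrite block_mxEur mxE eq_rlshift oppr0.
Qed.

Lemma partial_cst m (i : 'I_m) (c : R) x : partial i (fun=> c) x = 0.
Proof. exact: derive_cst. Qed.

(** Gamma^k_00 involves only derivatives of the entries g_0l, all constant. *)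
Lemma christoffel_time (a : chart A) k x :
  christoffel (grw_metric I f gF a) k 0 0 x = 0.
Proof.
rewrite /christoffel big1 ?mulr0// => l _.
under [fun y => grw_metric I f gF a y 0 l]eq_fun do rewrite grw_metric_time.
under [fun y => grw_metric I f gF a y 0 0]eq_fun do rewrite grw_metric_time.
by rewrite !partial_cst addr0 subr0 mulr0.
Qed.

Lemma e0E j : e0 0 j = (j == 0)%:R.
Proof.
have -> : (0 : 'I_(1 + n)) = lshift n (0 : 'I_1) by exact/val_inj.
rewrite /e0; case: (split_ordP j) => k ->.
  by rewrite row_mxEl !mxE (inj_eq (@lshift_inj _ _)) eq_sym.
by rewrite row_mxEr mxE eq_rlshift.
Qed.

Lemma comoving_geodesic (hM : grw_spacetime I f gF) :
  geodesic (grw_metric I f gF) I gamma.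
Proof.
split.
- exact: grw_open hM.
- exact: grw_interval hM.
- exact: grw_nonempty hM.
- move=> s Is.
  have [a ap] := charts_cover (riemannian_smooth_manifold (grw_fiber hM)) p.
  by exists a.
- move=> s _.
  exact: (@cvg_pair _ _ _ (nbhs s) (nbhs s) (nbhs p) _ _ _ id (cst p)
    (@cvg_id _ _) (cvg_cst p)).
- by move=> a; rewrite coord_comoving; exact: smooth_affine.
- move=> a s Is _ x k.
  rewrite /x coord_comoving derive1n2_affine derive1_affine /cst mxE add0r.
  rewrite big1// => i _; rewrite big1// => j _; rewrite !e0E.
  have [->|_] := eqVneq i 0; last by rewrite mulr0 mul0r.
  have [->|_] := eqVneq j 0; last by rewrite mulr0.
  by rewrite christoffel_time !mul0r.
Qed.

Lemma comoving_geodesic_timelike : timelike (grw_metric I f gF) I gamma.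
Proof.
move=> a s _ _; rewrite coord_comoving derive1_affine /cst.
rewrite /bilin /e0 /grw_metric tr_row_mx mul_row_block mul_row_col.
by rewrite !mul0mx trmx0 !mulmx0 !addr0 mul1mx trmx1 mulmx1 mxE ltrN10.
Qed.

(** An extension cannot be continued past an end e of I: by continuity its time
    component at e would be e itself, which is not in I.  In the proof, I is
    shown to be both open and closed in the larger interval, which treats the
    two ends at once. *)
Lemma comoving_geodesic_inextendible (hM : grw_spacetime I f gF) :
  inextendible_geodesic (grw_metric I f gF) I gamma.
Proof.
split=> [|J' gamma' hg IJ' agree]; first exact: comoving_geodesic.
have J'conn : connected J'.
  exact/connected_intervalP/(geodesic_interval hg).
apply/esym; apply: J'conn.
- exact: grw_nonempty hM.
- by exists I; [exact: grw_open hM|apply/esym/setIidr].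
- exists (closure I); first exact: closed_closure.
  apply/seteqP; split=> [s Is|e [J'e Ie]].
    by split; [exact: IJ'|exact: subset_closure].
  have [a [I1 _]] := geodesic_in hg J'e.
  suff <- : (gamma' e).1 = e by [].
  apply: (@eq_on_closure _ _ (fst \o gamma') id I) => //.
  + by move=> s Is /=; rewrite agree.
  + apply: continuous_comp; first exact: (geodesic_continuous hg).
    exact: cvg_fst.
Qed.

(** Both the value f t0 > 0 and 0 would be limits of f along the punctured
    neighbourhoods of t0, which are nontrivial in R. *)
Lemma vanishing_limit_notin t0 (hM : grw_spacetime I f gF) :
  f t @[t --> within I t0^'] --> 0 -> ~ I t0.
Proof.
move=> f0 It0.
have fc : {for t0, continuous f} by have [] := grw_warping_smooth hM nil It0.
(* as I is open, being in I is no restriction near t0 *)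
have wE : within I t0^' = t0^'.
  apply/seteqP; split=> B.
    rewrite /within /= => IB.
    have : t0^' I.
      apply: nbhs_dnbhs; apply: open_nbhs_nbhs.
      by split; [exact: grw_open hM|].
    by apply: filterS2 IB => x IBx; exact: IBx.
  by apply: filterS => x Bx _.
rewrite wE in f0.
have f1 : f t @[t --> t0^'] --> f t0 by exact: cvg_within_filter.
have := grw_warping_pos hM It0.
by rewrite (cvg_unique _ f1 f0)// ltxx.
Qed.

End ComovingGeodesic.

Theorem theorem6p6 (R : realType) (n : nat) (F : topologicalType)
    (A : atlas R n F) (gF : metric A) (I : set R) (f : R -> R)
    (hM : grw_spacetime I f gF)
    (ht0 : exists t0 : R, closure I t0 /\ f t @[t --> within I (t0^')] --> 0) :
  exists (J : set R) (gamma : R -> R * F),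
    [/\ geodesic (grw_metric I f gF) J gamma,
        timelike (grw_metric I f gF) J gamma &
        incomplete_geodesic (grw_metric I f gF) J gamma].
Proof.
have [t0 [_ f0]] := ht0.
have [p _] := manifold_nonempty (riemannian_smooth_manifold (grw_fiber hM)).
exists I, (fun s => (s, p)); split.
- exact: comoving_geodesic.
- exact: comoving_geodesic_timelike.
- split; first exact: comoving_geodesic_inextendible.
  by move=> IT; apply: (vanishing_limit_notin hM f0); rewrite IT.
Qed.
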